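(* Let $1\le N\le L$, $1\le k\le L-1$, and let $\psi_1,\dots,\psi_L\in\mathrm{Span}\{\varphi_1,\dots,\varphi_L\}$ be orthonormal. Let $(\alpha_I)$, indexed by the subsets $I\subset\{1,\dots,L\}$ with $|I|=N$, be complex coefficients with $\sum_I|\alpha_I|^2=1$, and let $$\Psi=\sum_{I\subset\{1,\dots,L\},\,|I|=N}\alpha_I\,\Psi_{[I]},\qquad \Psi_{[I]}=|\psi_{i_1},\dots,\psi_{i_N}\rangle\ \text{ for } I=\{i_1<\dots<i_N\}.$$ Let $\hat\Psi$ (resp. $\hat\Psi^{(I)}$) be the occupation tensor of $\Psi$ (resp. $\Psi_{[I]}$) with respect to the basis $\{\varphi_1,\dots,\varphi_L\}$. Let $\sigma_1\ge\sigma_2\ge\dots$ be the singular values of the matrix reshape $\hat\Psi^{\mu_1,\dots,\mu_k}_{\mu_{k+1},\dots,\mu_L}$, and let $\sigma^{(I)}_1\ge\sigma^{(I)}_2\ge\dots$ be the singular values of $(\hat\Psi^{(I)})^{\mu_1,\dots,\mu_k}_{\mu_{k+1},\dots,\mu_L}$ (in each case all $2^{\min(k,L-k)}$ singular values, zeros included). Then for all $1\le j\le 2^{\min(k,L-k)}$ and any positive integers $j_I$ such that $\sum_{I\subset\{1,\dots,L\},\,|I|=N}j_I=j$, $$\sigma_j\le\sum_{I\subset\{1,\dots,L\},\,|I|=N}|\alpha_I|\,\sigma^{(I)}_{j_I}.$$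
   Context: Fix a single-particle basis $\{\varphi_1,\dots,\varphi_L\}$, i.e. an $L^2$-orthonormal set of functions in $H^1(\mathbb{R}^3\times\{\pm\frac12\})$. For orthonormal functions $f_1,\dots,f_N$ the Slater determinant is $|f_1,\dots,f_N\rangle(x_1,\dots,x_N)=\frac1{\sqrt{N!}}\det(f_i(x_j))_{i,j=1}^N$. The coefficients of the $\psi_i$ in the basis $\{\varphi_j\}$ are real. Occupation tensor: for an $N$-particle wavefunction $\Phi=\sum_{1\le i_1<\dots<i_N\le L}c_{i_1\dots i_N}|\varphi_{i_1},\dots,\varphi_{i_N}\rangle$, the tensor $\hat\Phi=(\hat\Phi_{\mu_1\dots\mu_L})_{\mu\in\{0,1\}^L}$ is defined by $\hat\Phi_{\mu_1\dots\mu_L}=0$ if $\sum_i\mu_i\ne N$, and $\hat\Phi_{\mu_1\dots\mu_L}=c_{i_1\dots i_N}$ if $i_1<\dots<i_N$ are exactly the indices with $\mu_i=1$. The matrix reshape $\hat\Phi^{\mu_1,\dots,\mu_k}_{\mu_{k+1},\dots,\mu_L}$ is the $2^k\times 2^{L-k}$ matrix with rows indexed by $(\mu_1,\dots,\mu_k)\in\{0,1\}^k$, columns indexed by $(\mu_{k+1},\dots,\mu_L)\in\{0,1\}^{L-k}$, and entries $\hat\Phi_{\mu_1\dots\mu_L}$. *)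

(* Defs.v *)
From HB Require Import structures.
From mathcomp Require Import all_boot all_order all_algebra.
From mathcomp Require Import complex.
From mathcomp Require Import all_classical all_reals all_analysis.

Set Implicit Arguments.
Unset Strict Implicit.
Unset Printing Implicit Defensive.

Import Order.TTheory GRing.Theory Num.Theory numFieldNormedType.Exports.

Local Open Scope classical_set_scope.
Local Open Scope ring_scope.

Definition normc (R : realType) (z : R[i]) : R := complex.Re `|z|.

Section L2.
Context (d : measure_display) (X : measurableType d) (R : realType).
Variable mu : {measure set X -> \bar R}.
Implicit Types f g : X -> R[i].

Definition ae_eq_fun f g : Prop := {ae mu, forall x, f x = g x}.

Definition square_integrable f : Prop :=
  [/\ measurable_fun setT (fun x => complex.Re (f x)),
      measurable_fun setT (fun x => complex.Im (f x)) &
      (\int[mu]_x ((normc (f x)) ^+ 2)%:E < +oo)%E].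

Definition inner f g : R[i] :=
  Complex (\int[mu]_x complex.Re ((f x)^* * g x))
          (\int[mu]_x complex.Im ((f x)^* * g x)).

Definition orthonormal_family (n : nat) (f : 'I_n -> X -> R[i]) : Prop :=
  (forall i, square_integrable (f i)) /\
  (forall i j, inner (f i) (f j) = (i == j)%:R).

Definition in_real_span (n : nat) (f : 'I_n -> X -> R[i]) g : Prop :=
  exists a : 'I_n -> R,
    ae_eq_fun g (fun x => \sum_j (a j)%:C%C * f j x).

(* The [n]-fold product of [mu], by iterated integration as in
   [product_measure1]; the library has no measure on [n.-tuple X] *)
Fixpoint tuple_measure (n : nat) : set (n.-tuple X) -> \bar R :=
  match n with
  | 0 => fun A => \d_([tuple] : 0.-tuple X) A
  | m.+1 => fun A =>
      (\int[mu]_x tuple_measure [set t : m.-tuple X | A [tuple of x :: t]])%E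
  end.

Definition ae_eq_wavefun (n : nat) (F G : n.-tuple X -> R[i]) : Prop :=
  almost_everywhere (@tuple_measure n) [set x | F x = G x].

Definition slater (n : nat) (f : 'I_n -> X -> R[i]) (x : n.-tuple X) : R[i] :=
  ((Num.sqrt n`!%:R)^-1)%:C%C *
  \det (\matrix_(i < n, j < n) f i (tnth x j)).

End L2.

Definition subsets (L N : nat) := {I : {set 'I_L} | #|I| == N}.

HB.instance Definition _ (L N : nat) := Finite.on (subsets L N).

(* [enum_val] lists a set of ordinals in increasing order *)
Definition element (L N : nat) (I : subsets L N) (k : 'I_N) : 'I_L :=
  enum_val (cast_ord (esym (eqP (valP I))) k).

Definition occupied (L : nat) (m : L.-tuple bool) : {set 'I_L} :=
  [set i | tnth m i].

Section OccupationTensor.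
Context (d : measure_display) (X : measurableType d) (R : realType).
Variable mu : {measure set X -> \bar R}.
Variables (L N : nat) (phi : 'I_L -> X -> R[i]).

Definition slater_subset (I : subsets L N) : N.-tuple X -> R[i] :=
  slater (fun k => phi (element I k)).

Definition is_occupation_tensor (Phi : N.-tuple X -> R[i])
    (T : L.-tuple bool -> R[i]) : Prop :=
  exists c : subsets L N -> R[i],
  [/\ ae_eq_wavefun mu Phi (fun x => \sum_I c I * slater_subset I x),
      forall m, #|occupied m| != N -> T m = 0 &
      forall m (I : subsets L N), val I = occupied m -> T m = c I].

(* The tensor exists as soon as [Phi] is a combination of Slater determinants
   of [phi], and it is unique when [phi] is orthonormal *)
Definition occupation_tensor (Phi : N.-tuple X -> R[i]) : L.-tuple bool -> R[i] :=
  xget (fun=> 0) [set T | is_occupation_tensor Phi T].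

End OccupationTensor.

Lemma card_bits (n : nat) : (2 ^ n)%N = #|{: n.-tuple bool}|.
Proof. by rewrite card_tuple card_bool. Qed.

Definition bits (n : nat) (r : 'I_(2 ^ n)) : n.-tuple bool :=
  enum_val (cast_ord (card_bits n) r).

Definition reshape_mx (C : Type) (L k : nat) (T : L.-tuple bool -> C) :
    'M[C]_(2 ^ k, 2 ^ (L - k)) :=
  \matrix_(r, c) T [tuple nth false (bits r ++ bits c) i | i < L].

(* The square roots of the eigenvalues of [M^* M], with multiplicity, in
   decreasing order; of the [n] of them, at least [n - m] vanish, and the first
   [minn m n] are kept *)
Definition singular_values (R : realType) (m n : nat) (M : 'M[R[i]]_(m, n)) :
    seq R :=
  take (minn m n)
    (sort (fun x y => y <= x)
       [seq Num.sqrt (complex.Re (spectral_diag (map_mx Num.conj M^T *m M) 0 i))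
          | i : 'I_n]).

(* [j] is 1-based *)
Definition singular_value (R : realType) (m n : nat) (M : 'M[R[i]]_(m, n))
    (j : nat) : R :=
  nth 0 (singular_values M) j.-1.

Notation R3 R :=
  (measurableTypeR R * measurableTypeR R * measurableTypeR R)%type.

(* The spin variable -1/2, 1/2 is encoded as a boolean *)
Notation config R := (R3 R * bool)%type.

Definition lebesgue3 (R : realType) : {measure set (R3 R) -> \bar R} :=
  ((@lebesgue_measure R \x @lebesgue_measure R) \x @lebesgue_measure R)%E.

Definition spin_measure (R : realType) : set bool -> \bar R := counting.

HB.instance Definition _ (R : realType) := Measure.on (@spin_measure R).

Lemma spin_measure_fin (R : realType) : fin_num_fun (@spin_measure R).
Proof.
move=> A _; rewrite /spin_measure /counting asboolT //.
exact: finite_finset.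
Qed.

HB.instance Definition _ (R : realType) :=
  @Measure_isFinite.Build _ _ _ (@spin_measure R) (@spin_measure_fin R).

Definition config_measure (R : realType) :
    {measure set (config R) -> \bar R} :=
  (lebesgue3 R \x @spin_measure R)%E.

Section Sobolev.
Context (R : realType).
Implicit Types (u g : R3 R -> R) (f : R * R * R -> R).

Definition unit_vector (i : 'I_3) : (R * R * R)%type :=
  ((val i == 0%N)%:R, (val i == 1%N)%:R, (val i == 2%N)%:R).

Definition partial (i : 'I_3) f : (R * R * R)%type -> R :=
  fun x => 'D_(unit_vector i) f x.

Definition smooth f : Prop := forall s : seq 'I_3,
  continuous (foldr partial f s) /\
  forall i x, derivable (foldr partial f s) x (unit_vector i).

Definition test_function f : Prop :=
  smooth f /\ compact (closure [set x | f x != 0]).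

Definition real_L2 u : Prop :=
  measurable_fun setT u /\ (\int[lebesgue3 R]_x ((u x) ^+ 2)%:E < +oo)%E.

Definition weak_partial (i : 'I_3) u g : Prop := forall f, test_function f ->
  \int[lebesgue3 R]_x (u x * partial i f x) = - \int[lebesgue3 R]_x (g x * f x).

Definition real_H1 u : Prop :=
  real_L2 u /\ forall i, exists g, real_L2 g /\ weak_partial i u g.

Definition spin_H1 (f : config R -> R[i]) : Prop := forall s,
  real_H1 (fun x => complex.Re (f (x, s))) /\
  real_H1 (fun x => complex.Im (f (x, s))).

End Sobolev.

(* Main.v *)
From HB Require Import structures.
Require Import Defs.
From mathcomp Require Import all_boot all_order all_fingroup all_algebra.
From mathcomp Require Import complex.
From mathcomp Require Import all_classical all_reals all_analysis measurable_realfun.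
From mathcomp Require Import ring lra zify.
Import Order.TTheory GRing.Theory Num.Theory.
Local Open Scope ring_scope.
Set Implicit Arguments.
Unset Strict Implicit.
Unset Printing Implicit Defensive.

(** The statement combines a fact about singular values with a fact about
    occupation tensors.

    Singular values: for matrices [M_i] and scalars [a_i], [sigma_j (\sum_i a_i
    M_i) <= \sum_i |a_i| sigma_(j_i) (M_i)] whenever the [j_i] are positive with
    sum [j] ([singular_value_sum]); this is the inequality of Weyl and Ky Fan,
    proved by counting dimensions. The row vectors whose norm grows by a factor
    of at most [sigma_(j_i)] under right multiplication by the adjoint of [M_i]
    contain a subspace of codimension at most [j_i - 1], spanned by eigenvectors
    of the Gram matrix ([singular_value_le_subspace]), so all these subspaces
    meet in codimension at most [j - 1]. The intersection therefore meets the
    subspace of dimension at least [j] on which, for the sum, this factor is at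
    least [sigma_j] ([singular_value_ge_subspace]), and the triangle inequality
    on a common nonzero vector is the claim.

    Occupation tensors: the tensor depends linearly on the wavefunction
    ([occupation_tensor_sum]).  As the tensor is a chosen witness, this needs
    existence and uniqueness of the coefficients in the basis of Slater
    determinants.  Existence is the expansion of a determinant whose rows are
    linear combinations ([slater_expand]), valid off the null set of tuples with
    a coordinate where some [psi_i] differs from its expansion.  Uniqueness is
    linear independence almost everywhere: an orthonormal family is linearly
    independent almost everywhere, hence so are the product functions
    [phi_(s_1)(t_1) ... phi_(s_n)(t_n)], by freezing one coordinate at a time
    ([tensor_lin_indep]); no integral over the product space is computed.  A
    combination of Slater determinants is a combination of such products from
    which each coefficient can be read off ([monomial_coef_element]). *)

(** * Norms of row vectors and subspaces spanned by eigenvectors *)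

Section Gram.
Variable C : numClosedFieldType.
Local Notation "M ^t*" := (map_mx Num.conj M^T) (at level 30).
Local Notation nm u := (sqrtC (dotmx u u)).

Lemma dotmx_sum n (u : 'rV[C]_n) : dotmx u u = \sum_i `|u 0 i| ^+ 2.
Proof.
by rewrite dotmxE mxE; apply: eq_bigr => i _; rewrite !mxE normCK.
Qed.

Lemma dotmx_ge0 n (u : 'rV[C]_n) : 0 <= dotmx u u.
Proof. exact: (dnorm_ge0 (@dotmx C n)). Qed.

Lemma dotmx_unitary n (P : 'M[C]_n) (u : 'rV[C]_n) :
  P \is unitarymx -> dotmx u u = \sum_i `|(u *m P^t*) 0 i| ^+ 2.
Proof.
move=> Pu; rewrite -dotmx_sum !dotmxE trmx_mul map_mxM trmxCK.
rewrite -mulmxA (mulmxA _ P).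
by rewrite -(invmx_unitary Pu) mulVmx ?mul1mx ?unitarymx_unit.
Qed.

(** In the coordinates [w] given by an orthonormal eigenbasis of [M^* M], the
    squared norm of the image of [u] is [\sum_i lambda_i |w_i|^2]. *)
Lemma dotmx_gram m n (M : 'M[C]_(m, n)) (u : 'rV[C]_n) :
  dotmx (u *m M^t*) (u *m M^t*) =
  \sum_i spectral_diag (M^t* *m M) 0 i *
         `|(u *m (spectralmx (M^t* *m M))^t*) 0 i| ^+ 2.
Proof.
set G := M^t* *m M; set P := spectralmx G.
have Pu : P \is unitarymx by exact: spectral_unitarymx.
have GE : G = P^t* *m diag_mx (spectral_diag G) *m P.
  rewrite -(invmx_unitary Pu); apply/orthomx_spectralP/normalmxP.
  by rewrite /G trmx_mul map_mxM trmxCK.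
rewrite dotmxE trmx_mul map_mxM trmxCK mulmxA -(mulmxA u) -/G.
have -> : u *m G *m u^t* = (u *m P^t*) *m diag_mx (spectral_diag G) *m (u *m P^t*)^t*.
  by rewrite {1}GE trmx_mul map_mxM trmxCK !mulmxA.
rewrite mxE; apply: eq_bigr => i _.
move: (u *m P^t*) => w.
by rewrite mul_mx_diag !mxE normCK mulrAC mulrC.
Qed.

Lemma gram_eigenvalue_ge0 m n (M : 'M[C]_(m, n)) i :
  0 <= spectral_diag (M^t* *m M) 0 i.
Proof.
set P := spectralmx (M^t* *m M).
have /unitarymxP Pu : P \is unitarymx by exact: spectral_unitarymx.
have := dotmx_ge0 (row i P *m M^t*).
rewrite dotmx_gram -/P (bigD1 i) //= big1 => [|k /negPf ki].
  rewrite addr0 -row_mul Pu !mxE eqxx /= normr1 expr1n mulr1; exact.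
by rewrite -row_mul Pu !mxE eq_sym ki normr0 expr0n mulr0.
Qed.

(** The rows of [P] with index in [S] span the vectors whose coordinates in the
    orthonormal basis of rows of [P] vanish off [S]. *)
Lemma unitary_rowsub n (P : 'M[C]_n) (S : {set 'I_n}) :
  P \is unitarymx ->
  let W := rowsub (@enum_val _ (mem S)) P in
  \rank W = #|S| /\
  forall u : 'rV_n, (u <= W)%MS -> forall i, i \notin S -> (u *m P^t*) 0 i = 0.
Proof.
move=> Pu W; have /unitarymxP PP := Pu.
split.
  apply: mxrank_unitary; apply/row_unitarymxP => i j.
  rewrite !row_rowsub.
  by have /row_unitarymxP -> := Pu; rewrite (inj_eq enum_val_inj).
move=> u /submxP [x ->] i iS.
rewrite -mulmxA /W mul_rowsub_mx PP mxE big1 // => k _.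
rewrite !mxE; case: eqP => [ki|_]; last by rewrite mulr0.
by have kS : enum_val k \in S := enum_valP k; rewrite -ki kS in iS.
Qed.

Lemma norm_lincomb_le (I : Type) (r : seq I) n (a : I -> C) (u : I -> 'rV[C]_n) :
  nm (\sum_(i <- r) a i *: u i) <= \sum_(i <- r) `|a i| * nm (u i).
Proof.
elim/big_ind2: _ => [||i _].
- by rewrite dotmx_sum big1 ?sqrtC0 // => i _; rewrite mxE normr0 expr0n.
- move=> x1 y1 x2 y2 h1 h2; apply: le_trans (lerD h1 h2).
  exact: (triangle_lerif (@dotmx C n)).
- have -> : dotmx (a i *: u i) (a i *: u i) = `|a i| ^+ 2 * dotmx (u i) (u i).
    exact: (dnormZ (@dotmx C n)).
  rewrite sqrtCM ?sqrCK ?nnegrE ?exprn_ge0 //.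
  exact: dotmx_ge0.
Qed.

Lemma corank_bigcap (F : fieldType) (I : Type) (r : seq I) n (W : I -> 'M[F]_n) :
  (n - \rank (\bigcap_(i <- r) W i)%MS <= \sum_(i <- r) (n - \rank (W i)))%N.
Proof.
elim: r => [|i r IH]; first by rewrite !big_nil mxrank1 subnn.
rewrite !big_cons.
have := mxrank_sum_cap (W i) (\bigcap_(j <- r) W j)%MS.
have := rank_leq_col (W i + \bigcap_(j <- r) W j)%MS.
have := rank_leq_col (W i); have := rank_leq_col (\bigcap_(j <- r) W j)%MS.
move: IH; move: (\rank _) (\rank _) (\rank _) (\rank _) (\sum_(i <- r) _)%N; lia.
Qed.
End Gram.

(** * Counting entries of a decreasingly sorted family *)

Section SortedCount.
Variables (R : realType) (n : nat) (f : 'I_n -> R).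
Let s := sort (fun x y => y <= x) [seq f i | i : 'I_n].

Lemma size_sort_map : size s = n.
Proof. by rewrite size_sort size_map -cardE card_ord. Qed.

Lemma sorted_nth_ge a b : (a <= b < n)%N -> nth 0 s b <= nth 0 s a.
Proof.
case/andP=> ab bn.
apply: (@sorted_leq_nth R (fun x y => y <= x)) => //.
- by move=> x y z /= xy zx; apply: le_trans zx xy.
- by apply: sort_sorted => x y; exact: le_total.
- by rewrite inE size_sort_map (leq_ltn_trans ab).
- by rewrite inE size_sort_map.
Qed.

Lemma card_count (p : pred R) : #|[set i | p (f i)]| = count p s.
Proof.
rewrite count_sort count_map cardE /enum_mem size_filter -enumT.
rewrite count_filter.
by apply: eq_count => i; rewrite /= !inE andbT.
Qed.

Lemma card_gt_nth j : (j < n)%N -> (#|[set i | (nth 0 s j < f i)%R]| <= j)%N.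
Proof.
move=> jn; rewrite (card_count (fun x => nth 0 s j < x)).
rewrite -(cat_take_drop j s) count_cat.
rewrite [X in (_ + X)%N](_ : _ = 0%N); last first.
  apply/eqP; rewrite -leqn0 leqNgt -has_count.
  apply/(has_nthP 0) => -[k]; rewrite size_drop size_sort_map cat_take_drop => kn.
  by rewrite nth_drop ltNge sorted_nth_ge //; lia.
by rewrite addn0 (leq_trans (count_size _ _)) // size_take size_sort_map jn.
Qed.

Lemma card_ge_nth j : (j < n)%N -> (j < #|[set i | (nth 0 s j <= f i)%R]|)%N.
Proof.
move=> jn; rewrite (card_count (fun x => nth 0 s j <= x)).
rewrite -{2}(cat_take_drop j.+1 s) count_cat.
apply: leq_trans (leq_addr _ _).
rewrite (_ : count _ _ = size (take j.+1 s)); first by rewrite size_takel ?size_sort_map.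
apply/eqP; rewrite -all_count; apply/(all_nthP 0) => k.
rewrite size_takel ?size_sort_map // => kj.
by rewrite nth_take ?sorted_nth_ge //; lia.
Qed.
End SortedCount.

(** * Singular values of a linear combination of matrices *)

Section SingularValues.
Variable R : realType.
Local Notation C := R[i].
Local Notation "M ^t*" := (map_mx Num.conj M^T) (at level 30).
Local Notation nm u := (sqrtC (dotmx u u)).

(** The singular values before sorting, indexed like the rows of [spectralmx]. *)
Definition gram_sv m n (M : 'M[C]_(m, n)) i : R :=
  Num.sqrt (complex.Re (spectral_diag (M^t* *m M) 0 i)).

Lemma gram_svE m n (M : 'M[C]_(m, n)) i :
  spectral_diag (M^t* *m M) 0 i = ((gram_sv M i)%:C%C) ^+ 2.
Proof.
have d0 := gram_eigenvalue_ge0 M i.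
rewrite -rmorphXn /gram_sv sqr_sqrtr; first exact/esym/RRe_real/ger0_real.
by rewrite -ler0c RRe_real ?ger0_real.
Qed.

Lemma singular_valueE m n (M : 'M[C]_(m, n)) j : (0 < j <= minn m n)%N ->
  singular_value M j = nth 0 (sort (fun x y => y <= x) [seq gram_sv M i | i : 'I_n]) j.-1.
Proof. by move=> jb; rewrite /singular_value /singular_values nth_take //; lia. Qed.

Lemma singular_value_ge0 m n (M : 'M[C]_(m, n)) j : 0 <= singular_value M j.
Proof.
rewrite /singular_value /singular_values.
set s := take _ _.
case: (ltnP j.-1 (size s)) => [jn|jn]; last by rewrite nth_default.
have /mem_take := mem_nth 0 jn.
by rewrite mem_sort => /mapP [i _ ->]; exact: sqrtr_ge0.
Qed.

(** On the span of the eigenvectors indexed by [S], both squared norms are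
    diagonal in the same coordinates [w], so any bound on the singular values in
    [S] becomes a bound on norms. *)
Lemma gram_subspace m n (M : 'M[C]_(m, n)) (S : {set 'I_n}) :
  exists W : 'M[C]_n, \rank W = #|S| /\
    forall u : 'rV_n, (u <= W)%MS -> exists w : 'I_n -> C,
      dotmx u u = \sum_(i in S) `|w i| ^+ 2 /\
      dotmx (u *m M^t*) (u *m M^t*) =
        \sum_(i in S) (gram_sv M i)%:C%C ^+ 2 * `|w i| ^+ 2.
Proof.
have Pu := spectral_unitarymx (M^t* *m M).
have [rW oW] := unitary_rowsub S Pu.
exists <<rowsub (@enum_val _ (mem S)) (spectralmx (M^t* *m M))>>%MS.
split; first by rewrite genmxE.
move=> u; rewrite genmxE => /oW w0.
exists (fun i => (u *m (spectralmx (M^t* *m M))^t*) 0 i).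
rewrite dotmx_gram (dotmx_unitary u Pu); split; rewrite [RHS]big_mkcond.
  by apply: eq_bigr => i _; case: ifPn => // /w0 ->; rewrite normr0 expr0n.
apply: eq_bigr => i _; rewrite gram_svE.
by case: ifPn => // /w0 ->; rewrite normr0 expr0n mulr0.
Qed.

Lemma mulr_norm m (s : R) (u : 'rV[C]_m) : 0 <= s ->
  s%:C%C * nm u = sqrtC (s%:C%C ^+ 2 * dotmx u u).
Proof.
move=> s0; rewrite sqrtCM ?sqrCK ?nnegrE ?exprn_ge0 ?ler0c //.
exact: dotmx_ge0.
Qed.

(** The subspace is spanned by the eigenvectors with singular value at most
    [sigma_j], of which all but at most [j - 1] qualify. *)
Lemma singular_value_le_subspace m n (M : 'M[C]_(m, n)) j :
  (0 < j <= minn m n)%N ->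
  exists W : 'M[C]_n, (n - \rank W <= j.-1)%N /\
    forall u : 'rV_n, (u <= W)%MS ->
      nm (u *m M^t*) <= (singular_value M j)%:C%C * nm u.
Proof.
move=> jb; have s0 := singular_value_ge0 M j.
set S := [set i | gram_sv M i <= singular_value M j].
have [W [rW HW]] := gram_subspace M S; exists W; split.
  rewrite rW -[X in (X - _)%N]card_ord -(cardsC S) addKn.
  rewrite (_ : ~: S = [set i | singular_value M j < gram_sv M i]).
    by rewrite singular_valueE //; apply: card_gt_nth; lia.
  by apply/setP => i; rewrite !inE -ltNge.
move=> u /HW[w [uE MuE]].
rewrite mulr_norm // ler_sqrtC ?nnegrE ?mulr_ge0 ?exprn_ge0 ?ler0c ?dotmx_ge0 //.
rewrite MuE uE mulr_sumr; apply: ler_sum => i; rewrite inE => iS.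
by rewrite ler_wpM2r ?exprn_ge0 // -!rmorphXn lecR ler_pXn2r ?nnegrE ?sqrtr_ge0.
Qed.

Lemma singular_value_ge_subspace m n (M : 'M[C]_(m, n)) j :
  (0 < j <= minn m n)%N ->
  exists V : 'M[C]_n, (j <= \rank V)%N /\
    forall u : 'rV_n, (u <= V)%MS ->
      (singular_value M j)%:C%C * nm u <= nm (u *m M^t*).
Proof.
move=> jb; have s0 := singular_value_ge0 M j.
set S := [set i | singular_value M j <= gram_sv M i].
have [V [rV HV]] := gram_subspace M S; exists V; split.
  rewrite rV /S singular_valueE // -[X in (X <= _)%N]prednK; last by lia.
  by apply: card_ge_nth; lia.
move=> u /HV[w [uE MuE]].
rewrite mulr_norm // ler_sqrtC ?nnegrE ?mulr_ge0 ?exprn_ge0 ?ler0c ?dotmx_ge0 //.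
rewrite MuE uE mulr_sumr; apply: ler_sum => i; rewrite inE => iS.
by rewrite ler_wpM2r ?exprn_ge0 // -!rmorphXn lecR ler_pXn2r ?nnegrE ?sqrtr_ge0.
Qed.

Lemma normc_complex (z : C) : (Defs.normc z)%:C%C = `|z|.
Proof. by rewrite /Defs.normc RRe_real ?normr_real. Qed.

(** The codimensions of the subspaces of the [M i] add up to at most
    [\sum_i (jI i - 1) <= j - 1], because there is at least one index; hence
    their intersection [U] contains a nonzero vector of the subspace [V], of
    dimension at least [j], attached to the combination. *)
Lemma singular_value_sum (I : finType) m n (M : I -> 'M[C]_(m, n)) (a : I -> C)
    (jI : I -> nat) j :
  (0 < j <= minn m n)%N -> (forall i, 0 < jI i)%N -> (\sum_i jI i)%N = j ->
  singular_value (\sum_i a i *: M i) j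
    <= \sum_i Defs.normc (a i) * singular_value (M i) (jI i).
Proof.
move=> jb jI0 sj.
have jIb i : (0 < jI i <= minn m n)%N.
  by rewrite jI0 /=; move: sj; rewrite (bigD1 i) //=; lia.
have [W HW] := choice (fun i => singular_value_le_subspace (M i) (jIb i)).
have [V [rV HV]] := singular_value_ge_subspace (\sum_i a i *: M i) jb.
set U := (\bigcap_i W i)%MS.
have rU : (n - \rank U < j)%N.
  apply: leq_ltn_trans (corank_bigcap _ _) _.
  apply: (@leq_ltn_trans (\sum_i (jI i).-1)%N).
    by apply: leq_sum => i _; case: (HW i).
  (* an empty index type would give j = 0 *)
  have [i0 _|I0] := pickP I; last by move: sj jb; rewrite big_pred0 //; lia.
  rewrite -sj (bigD1 i0) //= [X in (_ < X)%N](bigD1 i0) //=.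
  rewrite -addSn prednK // leq_add2l; apply: leq_sum => i _; exact: leq_pred.
have : (V :&: U)%MS != 0.
  rewrite -mxrank_eq0; have := mxrank_sum_cap V U.
  by have := rank_leq_col (V + U)%MS; have := rank_leq_col U; lia.
case/rowV0Pn => u; rewrite sub_capmx => /andP [uV /sub_bigcapmxP uU] u0.
have nu0 : 0 < nm u by rewrite sqrtC_gt0 (dnorm_gt0 (@dotmx _ _)).
rewrite -lecR -(ler_pM2r nu0); apply: le_trans (HV _ uV) _.
have -> : u *m (\sum_i a i *: M i)^t* = \sum_i (a i)^* *: (u *m (M i)^t*).
  rewrite raddf_sum /= map_mx_sum mulmx_sumr; apply: eq_bigr => i _.
  by rewrite linearZ /= map_mxZ scalemxAr.
apply: le_trans (norm_lincomb_le _ _ _) _.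
rewrite rmorph_sum mulr_suml; apply: ler_sum => i _.
rewrite rmorphM /= normc_complex norm_conjC -mulrA ler_wpM2l //.
by have [_ ->] := HW i; rewrite ?uU.
Qed.
End SingularValues.

Local Open Scope classical_set_scope.

(** * The iterated measure on tuples *)

Section SigmaFiniteBundle.
Context d (T : measurableType d) (R : realType).
Variable m : {measure set T -> \bar R}.

(** An alias of [m] that carries a proof of sigma-finiteness, so that the
    structure can be found by canonical inference. *)
Definition sigma_finite_bundle of sigma_finite setT m : set T -> \bar R := m.

Hypothesis sf : sigma_finite setT m.

HB.instance Definition _ := Measure.on (sigma_finite_bundle sf).
HB.instance Definition _ :=
  @Measure_isSigmaFinite.Build _ _ _ (sigma_finite_bundle sf) sf.
End SigmaFiniteBundle.

Lemma sigma_finite_product d1 d2 (T1 : measurableType d1)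
    (T2 : measurableType d2) (R : realType) (m1 : {measure set T1 -> \bar R})
    (m2 : {sigma_finite_measure set T2 -> \bar R}) :
  sigma_finite setT m1 -> sigma_finite setT (m1 \x m2)%E.
Proof.
move=> /sigma_finiteP[F [TF ndF Foo]].
have /sigma_finiteP[G [TG ndG Goo]] := sigma_finiteT m2.
exists (fun k => F k `*` G k) => [|k].
  apply/seteqP; split => // -[x y] _.
  have [a _ Fa] : (\bigcup_k F k) x by rewrite -TF.
  have [b _ Gb] : (\bigcup_k G k) y by rewrite -TG.
  exists (maxn a b) => //; split => /=.
    by move: x Fa; apply/subsetPset/ndF/leq_maxl.
  by move: y Gb; apply/subsetPset/ndG/leq_maxr.
have [mF Fk] := Foo k; have [mG Gk] := Goo k.
split; first exact: measurableX.
by rewrite product_measure1E // lte_mul_pinfty // ge0_fin_numE.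
Qed.

Section TupleMeasure.
Context d (X : measurableType d) (R : realType).
Variable mu : {measure set X -> \bar R}.
Hypothesis mu_sf : sigma_finite setT mu.

Let cons_pair n (p : X * n.-tuple X) : n.+1.-tuple X := [the n.+1.-tuple X of p.1 :: p.2].

Lemma measurable_cons_pair n : measurable_fun setT (@cons_pair n).
Proof. by apply: measurable_cons; [exact: measurable_fst|exact: measurable_snd]. Qed.

Lemma tuple_measureS n (A : set (n.+1.-tuple X)) :
  tuple_measure mu A = (mu \x tuple_measure mu (n := n))%E (@cons_pair n @^-1` A).
Proof.
apply: eq_integral => x _ /=; congr (tuple_measure mu _).
by apply/seteqP; split => t /=; rewrite /xsection /= inE.
Qed.

(** [tuple_measure mu n.+1] is the image of the product of [mu] and
    [tuple_measure mu n] under [cons]; so it is a measure, and sigma-finite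
    because [cons] has a measurable inverse.  The equality is between set
    functions on all sets, so null sets agree as well. *)
Lemma tuple_measure_sigma_finite n :
  exists m : {sigma_finite_measure set (n.-tuple X) -> \bar R},
    tuple_measure mu (n := n) = m.
Proof.
elim: n => [|n [m mE]].
  by exists (\d_([tuple] : 0.-tuple X)).
have mc := @measurable_cons_pair n.
have [pm pE] : exists pm : {measure set (n.+1.-tuple X) -> \bar R},
    pushforward (mu \x m)%E (@cons_pair n) = pm.
  (* the measure structure of a pushforward takes measurability as an argument,
     which unification leaves open and mc fills *)
  by unshelve refine (ex_intro _ (pushforward (mu \x m)%E (@cons_pair n)
    : {measure set _ -> \bar R}) _).
have pmE : tuple_measure mu (n := n.+1) = pm.
  by rewrite -pE; apply/funext => A; rewrite tuple_measureS mE.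
have sf : sigma_finite setT pm.
  have [F FT Ff] := sigma_finite_product m mu_sf.
  exists (fun k => (fun t => (thead t, [tuple of behead t])) @^-1` F k).
    rewrite -preimage_bigcup -FT preimage_setT //.
  move=> k; have [mF lF] := Ff k; split.
    rewrite -[X in measurable X]setTI.
    suff mg : measurable_fun setT
        (fun t : n.+1.-tuple X => (thead t, [tuple of behead t])) by exact: mg.
    apply: measurable_fun_pair; [exact: measurable_tnth|exact: measurable_behead].
  rewrite -pE /pushforward -comp_preimage.
  rewrite (_ : _ \o _ = id) ?preimage_id //.
  apply/funext => -[x t] /=; rewrite theadE; congr pair; exact: val_inj.
by exists (sigma_finite_bundle sf); exact: pmE.
Qed.

(** Seen through [cons], the cylinder over [N] is a rectangle with a null side;
    the other side may have infinite measure, but [0 * +oo = 0]. *)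
Lemma tuple_measure_coord0 (N : set X) : measurable N -> mu N = 0%E ->
  forall n (k : 'I_n), tuple_measure mu [set t : n.-tuple X | N (tnth t k)] = 0%E.
Proof.
move=> mN N0; elim=> [[]//|n IH] k.
have [m mE] := tuple_measure_sigma_finite n.
rewrite tuple_measureS mE.
case: (unliftP ord0 k) => [k' ->|->].
  rewrite (_ : _ @^-1` _ = setT `*` [set t : n.-tuple X | N (tnth t k')]).
    rewrite product_measure1E // -?mE ?IH ?mule0 //.
    by rewrite -[X in measurable X]setTI; apply: (measurable_tnth k').
  by apply/seteqP; split => -[x t] /=; rewrite tnthS; [split|case].
rewrite (_ : _ @^-1` _ = N `*` setT).
  by rewrite product_measure1E //= N0 mul0e.
by apply/seteqP; split => -[x t] /=; rewrite tnth0; [split|case].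
Qed.

Lemma ae_tuple_coord n (P : X -> Prop) :
  {ae mu, forall x, P x} ->
  almost_everywhere (tuple_measure mu (n := n)) [set t | forall k, P (tnth t k)].
Proof.
move=> [N [mN N0 PN]].
have [m mE] := tuple_measure_sigma_finite n; rewrite mE.
apply: (@filter_forall _ _ (fun k => [set t : n.-tuple X | P (tnth t k)])
  (almost_everywhere m)) => k.
exists [set t : n.-tuple X | N (tnth t k)]; split.
- by rewrite -[X in measurable X]setTI; apply: (measurable_tnth k).
- by rewrite -mE; exact: tuple_measure_coord0.
- by move=> t Pt; apply: PN.
Qed.

(** By induction on [n]: for almost every value [x] of the first coordinate, the
    section at [x] of the exceptional null set is null, so the relation among the
    remaining coordinates makes each [\sum_i c (i :: s') phi_i(x)] vanish; this
    holds for almost every [x], and [phi] is independent. *)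
Lemma tensor_lin_indep (L : nat) (phi : 'I_L -> X -> R[i]) :
  (forall c : 'I_L -> R[i],
     {ae mu, forall x, \sum_i c i * phi i x = 0} -> forall i, c i = 0) ->
  forall n (c : n.-tuple 'I_L -> R[i]),
    almost_everywhere (tuple_measure mu (n := n))
      [set t | \sum_s c s * \prod_(k < n) phi (tnth s k) (tnth t k) = 0] ->
    forall s, c s = 0.
Proof.
move=> LI; elim=> [|n IH] c [N [mN N0 cN]] s.
  have : ~ N [tuple].
    by move=> N1; move: N0; rewrite /= diracE mem_set //= => /eqP; rewrite onee_eq0.
  move=> /(contra_notP (cN [tuple])) /=.
  rewrite (bigD1 ([tuple] : 0.-tuple 'I_L)) //= [X in _ + X]big1 => [|t].
    by rewrite addr0 big_ord0 mulr1 (tuple0 s).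
  by move=> /eqP[]; exact: (tuple0 t).
have [m mE] := tuple_measure_sigma_finite n.
have mN' : measurable (@cons_pair n @^-1` N).
  by rewrite -[X in measurable X]setTI; apply: measurable_cons_pair.
have : {ae mu, forall x, m (xsection (@cons_pair n @^-1` N) x) = 0%E}.
  move: N0; rewrite tuple_measureS mE /product_measure1 => N0.
  have := (ae_eq_integral_abs mu measurableT
    (measurable_fun_xsection m mN')).1.
  rewrite (eq_integral (m \o xsection (@cons_pair n @^-1` N))); last first.
    by move=> x _ /=; rewrite gee0_abs.
  by move=> /(_ N0); apply: filterS => x /=; apply.
move=> aeN; rewrite (tuple_eta s).
apply: (LI (fun i => c [tuple of i :: behead s])).
apply: filterS aeN => x Nx.
apply: (IH (fun s' => \sum_i c [tuple of i :: s'] * phi i x) _ [tuple of behead s]).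
exists (xsection (@cons_pair n @^-1` N) x); split.
- exact: measurable_xsection.
- by rewrite mE.
move=> t /= ct; rewrite /xsection /= inE; apply: cN => /= cx; apply: ct.
rewrite -[RHS]cx.
pose h (p : 'I_L * n.-tuple 'I_L) := [the n.+1.-tuple 'I_L of p.1 :: p.2].
rewrite (reindex h) /=; last first.
  exists (fun s => (thead s, [tuple of behead s])) => [[i s'] _|s' _] /=.
    by rewrite theadE; congr pair; exact: val_inj.
  by rewrite [RHS]tuple_eta.
rewrite -(pair_bigA _ (fun (i : 'I_L) (s' : n.-tuple 'I_L) => c [tuple of i :: s'] *
   \prod_(k < n.+1) phi (tnth [tuple of i :: s'] k) (tnth [tuple of x :: t] k))) /=.
rewrite exchange_big; apply: eq_bigr => s' _; rewrite mulr_suml.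
apply: eq_bigr => i _; rewrite big_ord_recl !tnth0 -mulrA; congr (_ * (_ * _)).
by apply: eq_bigr => k _; rewrite !tnthS.
Qed.
End TupleMeasure.

(** * Orthonormal families are linearly independent almost everywhere *)

Section Orthonormal.
Context d (X : measurableType d) (R : realType).
Variable mu : {measure set X -> \bar R}.
Local Notation Re := complex.Re.
Local Notation Im := complex.Im.

Lemma normc_sqr (z : R[i]) : Defs.normc z ^+ 2 = Re z ^+ 2 + Im z ^+ 2.
Proof.
by rewrite /Defs.normc normc_def /= sqr_sqrtr // addr_ge0 ?sqr_ge0.
Qed.

Lemma integrable_normc_sqr (f : X -> R[i]) : square_integrable mu f ->
  mu.-integrable setT (EFin \o (fun x => Defs.normc (f x) ^+ 2)).
Proof.
move=> [mR mI fi]; apply/integrableP; split.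
  apply/measurable_EFinP; under eq_fun do rewrite normc_sqr.
  by apply: measurable_funD; exact: measurable_funX.
by under eq_integral do rewrite /= ger0_norm ?sqr_ge0 //.
Qed.

Lemma integrable_inner (f g : X -> R[i]) :
  square_integrable mu f -> square_integrable mu g ->
  mu.-integrable setT (EFin \o (fun x => Re ((f x)^* * g x))) /\
  mu.-integrable setT (EFin \o (fun x => Im ((f x)^* * g x))).
Proof.
move=> sf sg.
have fgi : mu.-integrable setT
    (EFin \o (fun x => Defs.normc (f x) ^+ 2 + Defs.normc (g x) ^+ 2)).
  have := integrableD measurableT (integrable_normc_sqr sf) (integrable_normc_sqr sg).
  by apply: eq_integrable => // x _.
case: sf sg => [mRf mIf _] [mRg mIg _].
have ReE x : Re ((f x)^* * g x) = Re (f x) * Re (g x) + Im (f x) * Im (g x).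
  by case: (f x) (g x) => [a b] [c e] /=; ring.
have ImE x : Im ((f x)^* * g x) = Re (f x) * Im (g x) - Im (f x) * Re (g x).
  by case: (f x) (g x) => [a b] [c e] /=; ring.
split; apply: le_integrable fgi => //.
- apply/measurable_EFinP; under eq_fun do rewrite ReE.
  by apply: measurable_funD; exact: measurable_funM.
- move=> x _ /=; rewrite lee_fin ReE !normc_sqr [leRHS]ger0_norm; last first.
    by rewrite !addr_ge0 ?sqr_ge0.
  case: (f x) (g x) => [a b] [c e] /=.
  have := sqr_ge0 (a + c); have := sqr_ge0 (a - c); have := sqr_ge0 (b + e).
  have := sqr_ge0 (b - e); have := sqr_ge0 (a + e); have := sqr_ge0 (a - e).
  have := sqr_ge0 (b + c); have := sqr_ge0 (b - c).
  have := sqr_ge0 a; have := sqr_ge0 b; have := sqr_ge0 c; have := sqr_ge0 e.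
  rewrite ler_norml !expr2 => *; apply/andP; split; nra.
- apply/measurable_EFinP; under eq_fun do rewrite ImE.
  by apply: measurable_funB; exact: measurable_funM.
- move=> x _ /=; rewrite lee_fin ImE !normc_sqr [leRHS]ger0_norm; last first.
    by rewrite !addr_ge0 ?sqr_ge0.
  case: (f x) (g x) => [a b] [c e] /=.
  have := sqr_ge0 (a + c); have := sqr_ge0 (a - c); have := sqr_ge0 (b + e).
  have := sqr_ge0 (b - e); have := sqr_ge0 (a + e); have := sqr_ge0 (a - e).
  have := sqr_ge0 (b + c); have := sqr_ge0 (b - c).
  have := sqr_ge0 a; have := sqr_ge0 b; have := sqr_ge0 c; have := sqr_ge0 e.
  rewrite ler_norml !expr2 => *; apply/andP; split; nra.
Qed.

Lemma Rintegral_lincomb_ae0 (I : finType) (r : I -> R) (F : I -> X -> R) :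
  (forall i, mu.-integrable setT (EFin \o F i)) ->
  {ae mu, forall x, \sum_i r i * F i x = 0} ->
  \sum_i r i * \int[mu]_x F i x = 0.
Proof.
move=> iF ae0.
have iS : mu.-integrable setT (fun x => \sum_i (r i * F i x)%:E)%E.
  apply: integrable_sum => // i _.
  by have := integrableZl measurableT (r i) (iF i); apply: eq_integrable.
have : (\int[mu]_x (\sum_i (r i * F i x)%:E) = 0)%E.
  rewrite (@ae_eq_integral _ _ _ mu setT (cst 0%E)) //.
  - by rewrite integral0.
  - exact: measurable_int iS.
  - by apply: filterS ae0 => x r0 _; rewrite sumEFin r0.
rewrite integral_sum // => [sum0|i]; last first.
  by have := integrableZl measurableT (r i) (iF i); apply: eq_integrable.
apply: EFin_inj; rewrite -sumEFin -[RHS]sum0; apply: eq_bigr => i _.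
have -> : (\int[mu]_x (r i * F i x)%:E = \int[mu]_x ((r i)%:E * (F i x)%:E))%E.
  by apply: eq_integral.
rewrite integralZl //; last exact: iF.
by rewrite EFinM fineK //; apply: integrable_fin_num => //; exact: iF.
Qed.

(** Integrating the relation against the conjugate of [f i] leaves [c i], its real
    and imaginary parts being treated as two real relations among the real and
    imaginary parts of the products. *)
Lemma orthonormal_lin_indep n (f : 'I_n -> X -> R[i]) (c : 'I_n -> R[i]) :
  orthonormal_family mu f ->
  {ae mu, forall x, \sum_i c i * f i x = 0} -> forall i, c i = 0.
Proof.
move=> [sf f_on] ae0 i.
have iRe j := (integrable_inner (sf i) (sf j)).1.
have iIm j := (integrable_inner (sf i) (sf j)).2.
have IRe j : \int[mu]_x Re ((f i x)^* * f j x) = (i == j)%:R.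
  by have := congr1 (@complex.Re R) (f_on i j) => /= ->; case: (i == j).
have IIm j : \int[mu]_x Im ((f i x)^* * f j x) = 0.
  by have := congr1 (@complex.Im R) (f_on i j) => /= ->; case: (i == j).
pose F (p : bool * 'I_n) x :=
  if p.1 then Re ((f i x)^* * f p.2 x) else Im ((f i x)^* * f p.2 x).
have iF p : mu.-integrable setT (EFin \o F p) by case: p => -[] j; [exact: iRe|exact: iIm].
have sumE (r : bool * 'I_n -> R) (G : bool * 'I_n -> R) :
    \sum_p r p * G p = \sum_j (r (true, j) * G (true, j) + r (false, j) * G (false, j)).
  transitivity (\sum_b \sum_j r (b, j) * G (b, j)).
    by rewrite pair_bigA; apply: eq_bigr => -[].
  rewrite exchange_big /=; by apply: eq_bigr => j _; rewrite big_bool.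
have aeS x : \sum_j c j * f j x = 0 -> \sum_j c j * ((f i x)^* * f j x) = 0.
  move=> h; rewrite -[RHS](mulr0 ((f i x)^*)) -[in RHS]h mulr_sumr.
  by apply: eq_bigr => j _; rewrite mulrCA.
(* the real part of the relation, then its imaginary part *)
have := @Rintegral_lincomb_ae0 _
  (fun p : bool * 'I_n => if p.1 then Re (c p.2) else - Im (c p.2)) F iF.
have := @Rintegral_lincomb_ae0 _
  (fun p : bool * 'I_n => if p.1 then Im (c p.2) else Re (c p.2)) F iF.
rewrite !sumE /=.
have pick (a : 'I_n -> R) : \sum_j a j * \int[mu]_x Re ((f i x)^* * f j x) = a i.
  rewrite (bigD1 i) //= IRe eqxx mulr1 big1 ?addr0 // => j ji.
  by rewrite IRe eq_sym (negPf ji) mulr0.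
have drop0 (a b : 'I_n -> R) :
    \sum_j (a j * \int[mu]_x Re ((f i x)^* * f j x) +
            b j * \int[mu]_x Im ((f i x)^* * f j x)) = a i.
  by rewrite big_split /= pick [X in _ + X]big1 ?addr0 // => j _; rewrite IIm mulr0.
rewrite !drop0 => cI cR.
apply/eqP; rewrite eq_complex /= cI ?cR ?eqxx //;
  apply: filterS ae0 => x /aeS S0; rewrite sumE /F /=.
  rewrite -[RHS](congr1 (@complex.Re R) S0) raddf_sum.
  by apply: eq_bigr => j _; case: (c j) ((_)^* * _) => [a b] [u v] /=; rewrite mulNr.
rewrite -[RHS](congr1 (@complex.Im R) S0) raddf_sum.
by apply: eq_bigr => j _; case: (c j) ((_)^* * _) => [a b] [u v] /=; rewrite addrC.
Qed.
End Orthonormal.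

Local Close Scope classical_set_scope.

(** * Slater determinants in terms of product functions *)

Section Element.
Variables L N : nat.

Lemma element_inj (I : subsets L N) : injective (element I).
Proof. by move=> i j /enum_val_inj/cast_ord_inj. Qed.

Lemma mem_element (I : subsets L N) k : element I k \in val I.
Proof. exact: enum_valP. Qed.

Lemma element_onto (I : subsets L N) i : i \in val I -> exists k, element I k = i.
Proof.
move=> iI; exists (cast_ord (eqP (valP I)) (enum_rank_in iI i)).
by rewrite /element cast_ord_comp cast_ord_id enum_rankK_in.
Qed.

Lemma element_perm_eq (I J : subsets L N) (s : 'S_N) :
  (forall k, element I (s k) = element J k) -> I = J /\ s = 1%g.
Proof.
move=> IJ.
have EIJ : I = J.
  apply/val_inj/eqP; rewrite eq_sym eqEcard (eqP (valP I)) (eqP (valP J)) leqnn andbT.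
  apply/fintype.subsetP => i /element_onto [k <-]; rewrite -IJ; exact: mem_element.
split=> //; apply/permP => k; rewrite perm1; apply: (@element_inj I).
by rewrite IJ EIJ.
Qed.
End Element.

Section DetExpand.
Variable F : comNzRingType.

(** The Cauchy-Binet expansion before the terms are collected by image of [f]. *)
Lemma det_sum_rows (n L : nat) (A : 'I_n -> 'I_L -> F) (B : 'I_L -> 'I_n -> F) :
  \det (\matrix_(i, j) \sum_l A i l * B l j) =
  \sum_(f : {ffun 'I_n -> 'I_L}) (\prod_i A i (f i)) * \det (\matrix_(i, j) B (f i) j).
Proof.
rewrite /determinant; under [RHS]eq_bigr do rewrite mulr_sumr.
rewrite exchange_big; apply: eq_bigr => s _ /=.
under eq_bigr do rewrite mxE.
rewrite bigA_distr_bigA mulr_sumr; apply: eq_bigr => f _.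
rewrite big_split mulrCA; congr (_ * (_ * _)).
by apply: eq_bigr => i _; rewrite mxE.
Qed.
End DetExpand.

Section Slater.
Context d (X : measurableType d) (R : realType) (L N : nat).

(** A repeated row makes the determinant vanish; otherwise, sorting the rows
    changes it by a sign.  The coefficients depend only on [f], which lets
    [slater_expand] use the same ones at all points. *)
Lemma slater_reorder (f : 'I_N -> 'I_L) : exists e : subsets L N -> R[i],
  forall (phi : 'I_L -> X -> R[i]) t,
    slater (fun k => phi (f k)) t = \sum_J e J * slater_subset phi J t.
Proof.
have [f_inj|f_ninj] := boolP (injectiveb f); last first.
  exists (fun=> 0) => phi t; under eq_bigr do rewrite mul0r.
  rewrite big1 //.
  case/injectivePn: f_ninj => i [j ij fij].
  rewrite /slater (determinant_alternate ij) ?mulr0 // => k.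
  by rewrite !mxE fij.
move/injectiveP: f_inj => f_inj.
have cJ : #|[set f k | k in 'I_N]| == N by rewrite card_imset // card_ord.
pose J : subsets L N := Sub [set f k | k in 'I_N] cJ.
have fJ k : exists k', element J k' = f k.
  by apply: element_onto; rewrite imset_f.
have [s sE] := choice fJ.
have s_inj : injective s by move=> a b ab; apply: f_inj; rewrite -!sE ab.
exists (fun I => (I == J)%:R * (-1) ^+ perm s_inj) => phi t.
rewrite (bigD1 J) //= eqxx mul1r big1 ?addr0 => [|I /negPf ->]; last by rewrite !mul0r.
rewrite /slater_subset /slater mulrCA; congr (_ * _).
rewrite -det_perm -det_mulmx -row_permE; congr (\det _).
by apply/matrixP => i j; rewrite !mxE permE sE.
Qed.

Lemma slater_expand (a : 'I_L -> 'I_L -> R[i]) (I : subsets L N) :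
  exists c : subsets L N -> R[i],
  forall (phi psi : 'I_L -> X -> R[i]) (t : N.-tuple X),
    (forall k i, psi i (tnth t k) = \sum_j a i j * phi j (tnth t k)) ->
    slater_subset psi I t = \sum_J c J * slater_subset phi J t.
Proof.
have [e eE] := choice (fun f : {ffun 'I_N -> 'I_L} => slater_reorder f).
exists (fun J => \sum_(f : {ffun 'I_N -> 'I_L})
  (\prod_i a (element I i) (f i)) * e f J) => phi psi t psiE.
transitivity (\sum_(f : {ffun 'I_N -> 'I_L}) (\prod_i a (element I i) (f i)) *
    slater (fun k => phi (f k)) t).
  rewrite /slater_subset /slater.
  under [RHS]eq_bigr do rewrite mulrCA.
  rewrite -mulr_sumr.
  rewrite -(det_sum_rows (fun i l => a (element I i) l)
    (fun l j => phi l (tnth t j))); congr (_ * \det _).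
  by apply/matrixP => i j; rewrite !mxE psiE.
under eq_bigr do rewrite eE mulr_sumr.
rewrite exchange_big; apply: eq_bigr => J _; rewrite mulr_suml.
by apply: eq_bigr => f _; rewrite mulrA.
Qed.

(** The coefficient of [\prod_k phi (tnth s k) (tnth t k)] once the determinants
    of [\sum_J c J * slater_subset phi J t] are expanded by the Leibniz formula. *)
Definition monomial_coef (c : subsets L N -> R[i]) (s : N.-tuple 'I_L) : R[i] :=
  \sum_J \sum_(p : 'S_N) (s == [tuple element J (p k) | k < N])%:R *
    (c J * (((Num.sqrt N`!%:R)^-1)%:C%C * (-1) ^+ p)).

Lemma slater_sum_monomials (phi : 'I_L -> X -> R[i]) c t :
  \sum_J c J * slater_subset phi J t =
  \sum_s monomial_coef c s * \prod_(k < N) phi (tnth s k) (tnth t k).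
Proof.
rewrite /monomial_coef.
under [RHS]eq_bigr do rewrite mulr_suml.
rewrite exchange_big; apply: eq_bigr => J _.
under [RHS]eq_bigr do rewrite mulr_suml.
rewrite exchange_big /= /slater_subset /slater -det_tr /determinant mulrA !mulr_sumr.
apply: eq_bigr => p _.
rewrite (bigD1 [tuple element J (p k) | k < N]) //= eqxx mul1r.
rewrite [X in _ = _ + X]big1 ?addr0; last first.
  by move=> s /negPf ->; rewrite !mul0r.
rewrite !mulrA; congr (_ * _); apply: eq_bigr => k _.
by rewrite !mxE tnth_mktuple.
Qed.

(** Only the identity term of the determinant of [J] contributes to the product
    of the elements of [J] in increasing order. *)
Lemma monomial_coef_element c J :
  monomial_coef c [tuple element J k | k < N] = c J * ((Num.sqrt N`!%:R)^-1)%:C%C.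
Proof.
rewrite /monomial_coef (bigD1 J) //= (bigD1 1%g) //=.
have eqE I (p : 'S_N) : [tuple element J k | k < N] == [tuple element I (p k) | k < N] ->
    I = J /\ p = 1%g.
  move=> /eqP E; apply: element_perm_eq => k.
  by have := congr1 (fun s => tnth s k) E; rewrite !tnth_mktuple.
rewrite (_ : _ == _ = true); last first.
  by apply/eqP/eq_from_tnth => k; rewrite !tnth_mktuple perm1.
rewrite mul1r odd_perm1 mulr1 !big1 ?addr0 // => [I IJ|p p1].
  rewrite big1 // => p _; case: eqP => [/eqP/eqE[IE _]|]; last by rewrite mul0r.
  by rewrite IE eqxx in IJ.
case: eqP => [/eqP/eqE[_ pE]|]; last by rewrite mul0r.
by rewrite pE eqxx in p1.
Qed.

End Slater.

Local Open Scope classical_set_scope.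

(** * Linearity of the occupation tensor *)

Section OccupationTensor.
Context d (X : measurableType d) (R : realType).
Variable mu : {measure set X -> \bar R}.
Hypothesis mu_sf : sigma_finite setT mu.
Variables L N : nat.
Implicit Types (phi psi : 'I_L -> X -> R[i]) (c : subsets L N -> R[i]).

Definition tensor_of_coefs c (m : L.-tuple bool) : R[i] :=
  if insub (occupied m) is Some J then c J else 0.

Lemma ae_eq_wavefun_trans (F G H : N.-tuple X -> R[i]) :
  ae_eq_wavefun mu F G -> ae_eq_wavefun mu F H -> ae_eq_wavefun mu G H.
Proof.
have [m mE] := tuple_measure_sigma_finite mu_sf N.
rewrite /ae_eq_wavefun mE; apply: filterS2 => t /= <- <-.
by [].
Qed.

Lemma slater_coefs_unique phi c c' :
  orthonormal_family mu phi ->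
  ae_eq_wavefun mu (fun t => \sum_J c J * slater_subset phi J t)
                   (fun t => \sum_J c' J * slater_subset phi J t) ->
  forall J, c J = c' J.
Proof.
move=> ophi ae_cc' J.
have [m mE] := tuple_measure_sigma_finite mu_sf N.
have coef0 := tensor_lin_indep mu_sf
  (fun a => orthonormal_lin_indep (c := a) ophi) (c := monomial_coef (fun I => c I - c' I)).
have {}coef0 := coef0 _ [tuple element J k | k < N].
apply/eqP; rewrite -subr_eq0.
have r0 : ((Num.sqrt (N`!%:R : R))^-1)%:C%C != 0.
  by rewrite fmorph_eq0 invr_eq0 sqrtr_eq0 -ltNge ltr0n fact_gt0.
rewrite -(mulIr_eq0 _ (mulIf r0)) -(monomial_coef_element (fun I => c I - c' I)) coef0 ?eqxx //.
move: ae_cc'; rewrite /ae_eq_wavefun mE; apply: filterS => t /= eqt.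
rewrite -slater_sum_monomials.
under eq_bigr do rewrite mulrBl.
by rewrite sumrB eqt subrr.
Qed.

Lemma occupation_tensorE phi c (Phi : N.-tuple X -> R[i]) :
  orthonormal_family mu phi ->
  ae_eq_wavefun mu Phi (fun t => \sum_J c J * slater_subset phi J t) ->
  occupation_tensor mu phi Phi = tensor_of_coefs c.
Proof.
move=> ophi PhiE.
have isT : is_occupation_tensor mu phi Phi (tensor_of_coefs c).
  exists c; split=> // m.
    by rewrite /tensor_of_coefs => mN; rewrite insubN.
  by move=> I Im; rewrite /tensor_of_coefs -Im valK.
have [c' [c'E T0 Tc]] : is_occupation_tensor mu phi Phi (occupation_tensor mu phi Phi).
  exact: (xgetI (fun=> 0) isT).
apply/funext => m; rewrite /tensor_of_coefs; case: insubP => [I _ Im|mN].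
  rewrite (Tc _ I) //; apply: (slater_coefs_unique ophi).
  exact: ae_eq_wavefun_trans c'E PhiE.
by rewrite T0.
Qed.

(** The exceptional set consists of the tuples with a coordinate where one of the
    expansions of the [psi i] fails. *)
Lemma slater_subset_in_span phi psi (I : subsets L N) :
  (forall i, in_real_span mu phi (psi i)) ->
  exists c, ae_eq_wavefun mu (slater_subset psi I)
    (fun t => \sum_J c J * slater_subset phi J t).
Proof.
move=> /choice[a psiE].
have [c cE] := slater_expand X (fun i j => (a i j)%:C%C) I.
exists c.
have := ae_tuple_coord mu_sf N (filter_forall (ae_filter_ringOfSetsType mu) psiE).
have [m mE] := tuple_measure_sigma_finite mu_sf N.
rewrite /ae_eq_wavefun mE; apply: filterS => t /= psit.
by apply: cE => k i; exact: psit.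
Qed.

Lemma occupation_tensor_sum phi psi (alpha : subsets L N -> R[i]) :
  orthonormal_family mu phi ->
  (forall i, in_real_span mu phi (psi i)) ->
  occupation_tensor mu phi (fun t => \sum_I alpha I * slater_subset psi I t) =
  fun m => \sum_I alpha I * occupation_tensor mu phi (slater_subset psi I) m.
Proof.
move=> ophi spsi.
have [c cE] := choice (fun I => slater_subset_in_span I spsi).
rewrite (@occupation_tensorE phi (fun J => \sum_I alpha I * c I J)) //.
  apply/funext => m; under eq_bigr do rewrite (occupation_tensorE ophi (cE _)).
  rewrite /tensor_of_coefs; case: insubP => // _.
  by rewrite big1 // => I _; rewrite mulr0.
have [m mE] := tuple_measure_sigma_finite mu_sf N.
move: cE; rewrite /ae_eq_wavefun mE => /(filter_forall (ae_filter_ringOfSetsType m)).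
apply: filterS => t /= ct.
under eq_bigr do rewrite ct mulr_sumr.
rewrite exchange_big; apply: eq_bigr => J _ /=; rewrite mulr_suml.
by apply: eq_bigr => I _; rewrite mulrA.
Qed.
End OccupationTensor.

(** * The theorem *)

Lemma sigma_finite_config (R : realType) : sigma_finite setT (config_measure R).
Proof. by do 3 apply: sigma_finite_product; exact: sigma_finiteT. Qed.

Unset Implicit Arguments.
Local Close Scope classical_set_scope.

Theorem theorem2p4 (R : realType) (L N k : nat)
    (phi psi : 'I_L -> config R -> R[i])
    (alpha : subsets L N -> R[i]) (j : nat) (jI : subsets L N -> nat) :
  (1 <= N <= L)%N ->
  (1 <= k <= L - 1)%N ->
  (forall i, spin_H1 (phi i)) ->
  orthonormal_family (config_measure R) phi ->
  (forall i, in_real_span (config_measure R) phi (psi i)) ->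
  orthonormal_family (config_measure R) psi ->
  \sum_(I : subsets L N) normc (alpha I) ^+ 2 = 1 ->
  (1 <= j <= 2 ^ minn k (L - k))%N ->
  (forall I, 0 < jI I)%N ->
  (\sum_(I : subsets L N) jI I)%N = j ->
  let Psi := fun x : N.-tuple (config R) =>
    \sum_(I : subsets L N) alpha I * slater_subset psi I x in
  let sigma := singular_value
    (reshape_mx k (occupation_tensor (config_measure R) phi Psi)) in
  let sigmaI := fun I : subsets L N => singular_value
    (reshape_mx k
      (occupation_tensor (config_measure R) phi (slater_subset psi I))) in
  sigma j <= \sum_(I : subsets L N) normc (alpha I) * sigmaI I (jI I).
Proof.
move=> _ _ _ ophi spsi _ _ jb jI0 sj; cbv zeta.
rewrite occupation_tensor_sum //; last exact: sigma_finite_config.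
rewrite (_ : reshape_mx k _ = \sum_I alpha I *: reshape_mx k
    (occupation_tensor (config_measure R) phi (slater_subset psi I))).
  apply: singular_value_sum => //.
  case/andP: jb => -> /leq_trans; apply.
  by rewrite leq_min !leq_exp2l // geq_minl geq_minr.
apply/matrixP => r s; rewrite summxE mxE; apply: eq_bigr => I _.
by rewrite !mxE.
Qed.
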